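(* Let $RS=\{n\ge1:r(n)=1\}$, where $r$ is the Rudin–Shapiro sequence, and list $RS=(rs_n)_{n\ge1}$ in increasing order. Then $(rs_n)$ is uniformly behaved in $\mathbb N$; that is, for every real $0<\theta<1$, $$\lim_{N\to\infty}\frac1N\sum_{n=1}^N e^{2\pi i\,rs_n\theta}=0.$$
   Context: For a natural number $n$ let $f_{11}(n)$ be the number of (possibly overlapping) occurrences of the pattern $11$ in the binary expansion of $n$. The Rudin–Shapiro sequence is $r(n)=0$ if $f_{11}(n)$ is odd and $r(n)=1$ if $f_{11}(n)$ is even. *)

(* Defs.v *)
(* Stdlib world: concrete reals, with Coquelicot for complex numbers and limits. *)
From Stdlib Require Import Reals Arith List Lia ConstructiveEpsilon.
From Coquelicot Require Import Coquelicot.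

(* The binary expansion of n occupies bits 0, ..., log2 n (no leading zeros), so
   its pairs of adjacent digits start at bits 0, ..., log2 n - 1.  Each pair is
   tested separately, so overlapping occurrences all count. *)
Definition f11 (n : nat) : nat :=
  length (filter (fun i => andb (Nat.testbit n i) (Nat.testbit n (S i)))
                 (seq 0 (Nat.log2 n))).

Definition rudin_shapiro (n : nat) : nat := if Nat.odd (f11 n) then 0 else 1.

Definition RS (n : nat) : Prop := (1 <= n)%nat /\ rudin_shapiro n = 1%nat.

Lemma RS_dec (n : nat) : {RS n} + {~ RS n}.
Proof.
  unfold RS.
  destruct (le_dec 1 n); [|right; tauto].
  destruct (Nat.eq_dec (rudin_shapiro n) 1); [left | right]; tauto.
Defined.

Lemma f11_pow2 (k : nat) : f11 (2 ^ k) = 0%nat.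
Proof.
  unfold f11.
  assert (H : forall l, filter (fun i => andb (Nat.testbit (2 ^ k) i)
                          (Nat.testbit (2 ^ k) (S i))) l = nil).
  { induction l as [|i l IH]; [reflexivity|]. cbn [filter].
    rewrite !Nat.pow2_bits_eqb.
    destruct (Nat.eqb_spec k i); destruct (Nat.eqb_spec k (S i));
      try lia; exact IH. }
  now rewrite H.
Qed.

Lemma RS_unbounded (m : nat) : exists n, RS n /\ (m < n)%nat.
Proof.
  exists (2 ^ m)%nat.
  assert (Hm : (m < 2 ^ m)%nat) by (apply Nat.pow_gt_lin_r; lia).
  split; [split; [lia|] | exact Hm].
  unfold rudin_shapiro. now rewrite f11_pow2.
Qed.

Lemma RS_above_dec (m n : nat) :
  {RS n /\ (m < n)%nat} + {~ (RS n /\ (m < n)%nat)}.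
Proof.
  destruct (RS_dec n); [|right; tauto].
  destruct (lt_dec m n); [left | right]; tauto.
Defined.

Definition next_RS (m : nat) : nat :=
  proj1_sig (epsilon_smallest (fun n => RS n /\ (m < n)%nat)
                              (RS_above_dec m) (RS_unbounded m)).

(* The sequence proper is indexed from 1; [rs 0 = 0] only seeds the recursion
   and is not an element of RS. *)
Fixpoint rs (n : nat) : nat :=
  match n with
  | O => O
  | S k => next_RS (rs k)
  end.

Lemma next_RS_spec (m : nat) :
  RS (next_RS m) /\ (m < next_RS m)%nat /\
  forall k, RS k -> (m < k)%nat -> (next_RS m <= k)%nat.
Proof.
  unfold next_RS.
  destruct (epsilon_smallest _ _ _) as [n [[H1 H2] H3]]; cbn [proj1_sig].
  repeat split; try apply H1; try exact H2.
  intros k Hk Hmk. apply H3. now split.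
Qed.

Lemma rs_increasing (i j : nat) : (i < j)%nat -> (rs i < rs j)%nat.
Proof.
  induction 1 as [|j _ IH]; simpl.
  - apply next_RS_spec.
  - destruct (next_RS_spec (rs j)) as [_ [H _]]. lia.
Qed.

Lemma rs_range (m : nat) : RS m <-> exists n, (1 <= n)%nat /\ rs n = m.
Proof.
  split.
  - intros Hm.
    assert (H : forall n, (rs n < m)%nat \/ exists k, (1 <= k)%nat /\ rs k = m).
    { induction n as [|n [IH|IH]].
      - left. simpl. destruct Hm. lia.
      - destruct (next_RS_spec (rs n)) as [_ [_ H]].
        specialize (H m Hm IH).
        destruct (Nat.eq_dec (next_RS (rs n)) m) as [E|E].
        + right. exists (S n). split; [lia | exact E].
        + left. simpl. lia.
      - now right. }
    assert (Hge : forall n, (n <= rs n)%nat).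
    { induction n as [|n IH]; [lia|].
      pose proof (rs_increasing n (S n) (Nat.lt_succ_diag_r n)). lia. }
    destruct (H m) as [Hlt|He]; [|exact He].
    specialize (Hge m). lia.
  - intros [[|n] [Hn <-]]; [lia|]. simpl. apply next_RS_spec.
Qed.

(* exp(2 pi i x) *)
Definition expi2pi (x : R) : C := (cos (2 * PI * x), sin (2 * PI * x)).

(* A sequence (a_n)_{n >= 1} of natural numbers; the value [a 0] plays no role. *)
Definition uniformly_behaved (a : nat -> nat) : Prop :=
  forall theta : R, (0 < theta < 1)%R ->
    filterlim
      (fun N : nat =>
         (RtoC (/ INR N) *
            sum_n_m (fun n => expi2pi (INR (a n) * theta)) 1 N)%C)
      eventually (locally (RtoC 0)).

(* Main.v *)
Require Import Defs.
From Stdlib Require Import Reals Arith List Lia Lra.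
From Coquelicot Require Import Coquelicot.

(** Let [eps m] be the sign (-1)^(f11 m).  The indicator of RS on [m >= 1] is
    (1 + eps m) / 2, so with z = exp(2 pi i theta) the sum of z^(rs n) over
    [1 <= n <= N] is, up to a bounded error, half the sum of a geometric
    series and of the Rudin-Shapiro polynomial [S_M(z)], the sum of
    [eps m * z ^ m] over [m < M], at [M = rs N + 1].  The geometric part is
    bounded because z is not 1.  The rest needs two facts.

    - [|S_M(z)| <= 6 sqrt M] on the unit circle ([rs_poly_bound]).  Appending a
      digit gives [eps (2 m) = eps m] and [eps (2 m + 1) = (-1)^m eps m], hence
      [S_(2M)(z) = S_M(z^2) + z S_M(-z^2)] and the same with a minus sign for
      [S_(2M)(-z)].  By the parallelogram law the energy
      [|S_M(z)|^2 + |S_M(-z)|^2] exactly doubles when M doubles (and z is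
      squared), so it is of order M; an odd length costs only one extra
      unit term in each summand.

    - [rs N <= 7 N] ([rs_le_linear]): if m is odd then one of [2 m] and
      [2 m + 1] lies in RS, so RS has bounded gaps.

    Together they bound the sum over [n <= N] by a constant times [sqrt N],
    which is [o(N)]. *)

Open Scope nat_scope.

(** * The sign of f11 under appending a binary digit *)

Lemma filter_length_map_S (p : nat -> bool) (l : list nat) :
  length (filter p (map S l)) = length (filter (fun i => p (S i)) l).
Proof.
  induction l as [|i l IH]; [reflexivity|].
  simpl. destruct (p (S i)); simpl; now rewrite IH.
Qed.

Lemma f11_double (n : nat) : f11 (2 * n) = f11 n.
Proof.
  destruct (Nat.eq_dec n 0) as [->|Hn]; [reflexivity|].
  unfold f11. rewrite Nat.log2_double by lia.
  cbn [seq filter]. rewrite Nat.testbit_even_0. cbn [andb].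
  rewrite <- seq_shift, filter_length_map_S.
  f_equal. apply filter_ext. intros i.
  now rewrite !Nat.testbit_even_succ by lia.
Qed.

Lemma f11_succ_double (n : nat) :
  f11 (2 * n + 1) = (if Nat.odd n then 1 else 0) + f11 n.
Proof.
  destruct (Nat.eq_dec n 0) as [->|Hn]; [reflexivity|].
  unfold f11. rewrite Nat.log2_succ_double by lia.
  cbn [seq filter]. rewrite Nat.testbit_odd_0.
  rewrite Nat.testbit_odd_succ, Nat.bit0_odd by lia. cbn [andb].
  assert (E : length (filter (fun i => (Nat.testbit (2 * n + 1) i &&
                 Nat.testbit (2 * n + 1) (S i))%bool) (seq 1 (Nat.log2 n)))
            = length (filter (fun i => (Nat.testbit n i &&
                 Nat.testbit n (S i))%bool) (seq 0 (Nat.log2 n)))).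
  { rewrite <- seq_shift, filter_length_map_S.
    f_equal. apply filter_ext. intros i.
    now rewrite !Nat.testbit_odd_succ by lia. }
  destruct (Nat.odd n); cbn [length]; rewrite E; reflexivity.
Qed.

Definition rs_sign (n : nat) : C :=
  if Nat.odd (f11 n) then RtoC (-1) else RtoC 1.

Lemma Cmod_rs_sign (n : nat) : Cmod (rs_sign n) = 1%R.
Proof.
  unfold rs_sign. destruct (Nat.odd _); rewrite Cmod_R.
  - rewrite Rabs_left; lra.
  - apply Rabs_R1.
Qed.

Lemma RtoC_m1 : RtoC (-1) = (- RtoC 1)%C.
Proof. exact (RtoC_opp 1). Qed.

Lemma Cpow_m1 (n : nat) :
  (RtoC (-1) ^ n)%C = if Nat.odd n then RtoC (-1) else RtoC 1.
Proof.
  induction n as [|n IH]; [reflexivity|].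
  rewrite Cpow_S, IH, Nat.odd_succ, <- Nat.negb_odd.
  destruct (Nat.odd n); cbn [negb]; rewrite <- RtoC_mult; f_equal; ring.
Qed.

Lemma rs_sign_double (n : nat) : rs_sign (2 * n) = rs_sign n.
Proof. unfold rs_sign. now rewrite f11_double. Qed.

(** The appended digit 1 creates a new block 11 exactly when [n] ends in 1. *)
Lemma rs_sign_succ_double (n : nat) :
  rs_sign (2 * n + 1) = (RtoC (-1) ^ n * rs_sign n)%C.
Proof.
  rewrite Cpow_m1. unfold rs_sign.
  rewrite f11_succ_double, Nat.odd_add.
  destruct (Nat.odd n), (Nat.odd (f11 n)); cbn;
    rewrite <- RtoC_mult; f_equal; ring.
Qed.

(** * Square-root cancellation in the Rudin-Shapiro polynomials *)

Fixpoint Csum (f : nat -> C) (M : nat) : C :=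
  match M with
  | O => RtoC 0
  | S k => (Csum f k + f k)%C
  end.

Definition rs_poly (M : nat) (z : C) : C :=
  Csum (fun m => rs_sign m * z ^ m)%C M.

(** Even exponents come from [rs_sign_double]; at odd exponents the extra sign
    (-1)^m of [rs_sign_succ_double] is absorbed by evaluating at [- z ^ 2]. *)
Lemma rs_poly_double (M : nat) (z : C) :
  rs_poly (2 * M) z = (rs_poly M (z * z) + z * rs_poly M (- (z * z)))%C.
Proof.
  unfold rs_poly. induction M as [|M IH]; [simpl; ring|].
  replace (2 * S M) with (S (S (2 * M))) by lia. cbn [Csum]. rewrite IH.
  replace (S (2 * M)) with (2 * M + 1) by lia.
  rewrite rs_sign_double, rs_sign_succ_double.
  replace (- (z * z))%C with (RtoC (-1) * (z * z))%C by (rewrite RtoC_m1; ring).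
  rewrite Cpow_add_r, Cpow_1_r, !Cpow_mult_r, !Cpow_mult_l.
  replace ((z ^ 2) ^ M)%C with (z ^ M * z ^ M)%C.
  - ring.
  - rewrite <- Cpow_mult_l. f_equal. simpl. ring.
Qed.

Lemma rs_poly_S_triangle (M : nat) (z : C) :
  Cmod z = 1%R -> (Cmod (rs_poly (S M) z) <= Cmod (rs_poly M z) + 1)%R.
Proof.
  intros Hz. unfold rs_poly. cbn [Csum].
  eapply Rle_trans; [apply Cmod_triangle|].
  rewrite Cmod_mult, Cmod_rs_sign, Cmod_pow, Hz, pow1. lra.
Qed.

Lemma Cmod_sqr (z : C) : (Cmod z ^ 2 = fst z ^ 2 + snd z ^ 2)%R.
Proof.
  unfold Cmod. rewrite pow2_sqrt; [reflexivity|].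
  pose proof (pow2_ge_0 (fst z)). pose proof (pow2_ge_0 (snd z)). lra.
Qed.

Lemma Cmod_parallelogram (x y : C) :
  (Cmod (x + y) ^ 2 + Cmod (x - y) ^ 2 = 2 * (Cmod x ^ 2 + Cmod y ^ 2))%R.
Proof. rewrite !Cmod_sqr. destruct x, y. simpl. ring. Qed.

(** The two points [z] and [- z] are taken together because the pair, unlike a
    single value, obeys an exact recursion under doubling of the length. *)
Definition rs_energy (M : nat) (z : C) : R :=
  (Cmod (rs_poly M z) ^ 2 + Cmod (rs_poly M (- z)) ^ 2)%R.

(** Passing from [z] to [-z] changes the sign of the odd part of the
    polynomial only, so the parallelogram law turns the splitting into even
    and odd exponents into an exact doubling. *)
Lemma rs_energy_double (M : nat) (z : C) :
  Cmod z = 1%R -> rs_energy (2 * M) z = (2 * rs_energy M (z * z))%R.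
Proof.
  intros Hz. unfold rs_energy.
  rewrite !rs_poly_double.
  replace (- z * - z)%C with (z * z)%C by ring.
  replace (rs_poly M (z * z) + - z * rs_poly M (- (z * z)))%C
    with (rs_poly M (z * z) - z * rs_poly M (- (z * z)))%C by ring.
  rewrite Cmod_parallelogram, (Cmod_mult z), Hz. ring.
Qed.

(** By Minkowski's inequality the square root of the energy grows by at most
    [sqrt 2], the norm of the pair of added unit terms; 3/2 is a rational
    upper bound for it. *)
Lemma rs_energy_S (M : nat) (z : C) (t : R) :
  Cmod z = 1%R -> (0 <= t)%R -> (rs_energy M z <= t ^ 2)%R ->
  (rs_energy (S M) z <= (t + 3 / 2) ^ 2)%R.
Proof.
  intros Hz Ht H. unfold rs_energy in *.
  assert (Hz' : Cmod (- z) = 1%R) by now rewrite Cmod_opp.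
  pose proof (rs_poly_S_triangle M z Hz) as Ha.
  pose proof (rs_poly_S_triangle M (- z) Hz') as Hb.
  pose proof (Cmod_ge_0 (rs_poly M z)) as Ha0.
  pose proof (Cmod_ge_0 (rs_poly M (- z))) as Hb0.
  apply (fun H => pow_incr _ _ 2 (conj (Cmod_ge_0 _) H)) in Ha.
  apply (fun H => pow_incr _ _ 2 (conj (Cmod_ge_0 _) H)) in Hb.
  revert H Ha Hb Ha0 Hb0.
  generalize (Cmod (rs_poly M z)) (Cmod (rs_poly M (- z))).
  intros a b H Ha Hb Ha0 Hb0.
  assert (Hab : (a + b <= 3 / 2 * t)%R).
  { pose proof (pow2_ge_0 (a - b)). pose proof (pow2_ge_0 t).
    apply Rsqr_incr_0_var; [unfold Rsqr; lra | lra]. }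
  nra.
Qed.

(** Let [q M] be the square root of the energy.  The shift by 4 pays for the odd
    lengths: the recursion [q (2 M + 1) <= sqrt 2 * q M + 3/2] preserves a bound
    [q M <= a * sqrt M - c] as soon as [(sqrt 2 - 1) * c >= 3/2], which holds
    for [c = 4]; then [a = 6] makes it true at [M = 1], where [q 1 = sqrt 2]. *)
Lemma rs_energy_bound (M : nat) (z : C) :
  1 <= M -> Cmod z = 1%R ->
  (rs_energy M z <= (6 * sqrt (INR M) - 4) ^ 2)%R.
Proof.
  revert z. induction M as [M IH] using lt_wf_ind. intros z HM Hz.
  destruct (Nat.eq_dec M 1) as [->|HM1].
  { unfold rs_energy, rs_poly, rs_sign. simpl.
    rewrite !Cmult_1_l, Cplus_0_l, Cmod_1, sqrt_1. lra. }
  destruct (Nat.Even_or_Odd M) as [[K HK]|[K HK]].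
  all: assert (HzK : Cmod (z * z) = 1%R) by (rewrite Cmod_mult, Hz; ring).
  all: assert (IHK := IH K ltac:(lia) (z * z)%C ltac:(lia) HzK).
  all: assert (Hs1 : (1 <= sqrt (INR K))%R)
         by (rewrite <- sqrt_1; apply sqrt_le_1_alt; apply (le_INR 1); lia).
  all: assert (H2 : (1.41 <= sqrt 2 <= 1.42)%R)
         by (split; [apply Rsqr_incr_0_var | apply Rsqr_incr_0_var];
             try apply sqrt_pos; try rewrite Rsqr_sqrt by lra;
             unfold Rsqr; lra).
  all: assert (H22 : (sqrt 2 * sqrt 2 = 2)%R) by (apply sqrt_sqrt; lra).
  all: assert (HE := rs_energy_double K z Hz).
  all: assert (HD : (rs_energy (2 * K) z
                     <= (sqrt 2 * (6 * sqrt (INR K) - 4)) ^ 2)%R)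
         by (rewrite HE, Rpow_mult_distr;
             replace (sqrt 2 ^ 2)%R with 2%R by (rewrite <- H22 at 1; ring); lra).
  - subst M. rewrite mult_INR, sqrt_mult_alt by (simpl; lra).
    change (INR 2) with 2%R.
    eapply Rle_trans; [exact HD|]. apply pow_incr. nra.
  - subst M. replace (2 * K + 1) with (S (2 * K)) by lia.
    assert (Hle : (sqrt 2 * sqrt (INR K) <= sqrt (INR (S (2 * K))))%R).
    { rewrite <- sqrt_mult_alt by lra. apply sqrt_le_1_alt.
      rewrite S_INR, mult_INR. change (INR 2) with 2%R. lra. }
    eapply Rle_trans; [apply rs_energy_S; [exact Hz | | exact HD]; nra|].
    apply pow_incr. nra.
Qed.

Lemma rs_poly_bound (M : nat) (z : C) :
  Cmod z = 1%R -> (Cmod (rs_poly M z) <= 6 * sqrt (INR M))%R.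
Proof.
  intros Hz. destruct (Nat.eq_dec M 0) as [->|HM].
  { unfold rs_poly. simpl. rewrite Cmod_0, sqrt_0. lra. }
  assert (Hs1 : (1 <= sqrt (INR M))%R)
    by (rewrite <- sqrt_1; apply sqrt_le_1_alt; apply (le_INR 1); lia).
  pose proof (rs_energy_bound M z ltac:(lia) Hz) as H.
  unfold rs_energy in H.
  pose proof (pow2_ge_0 (Cmod (rs_poly M (- z)))).
  apply Rsqr_incr_0_var; [unfold Rsqr; nra | lra].
Qed.

(** * Sums along the enumeration of RS *)

Lemma Csum_extend_zero (f : nat -> C) (a b : nat) :
  a <= b -> (forall k, a <= k < b -> f k = RtoC 0) -> Csum f b = Csum f a.
Proof.
  induction 1 as [|b Hab IH]; intros H; [reflexivity|].
  simpl. rewrite IH by (intros; apply H; lia).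
  rewrite H by lia. ring.
Qed.

(** Between [rs N] and [rs (S N)] no integer lies in RS, so extending the sum
    past the gap adds only zero terms. *)
Lemma sum_rs_reindex (g : nat -> C) (N : nat) :
  sum_n_m (fun n => g (rs n)) 1 N =
  Csum (fun m => if RS_dec m then g m else RtoC 0) (S (rs N)).
Proof.
  induction N as [|N IH].
  { rewrite sum_n_m_zero by lia. simpl.
    destruct (RS_dec 0) as [[H _]|_]; [lia|].
    change (RtoC 0 = (RtoC 0 + RtoC 0)%C). now rewrite Cplus_0_l. }
  rewrite sum_n_Sm by lia. rewrite IH.
  destruct (next_RS_spec (rs N)) as [HRS [Hlt Hmin]].
  change (rs (S N)) with (next_RS (rs N)).
  set (f := fun m => if RS_dec m then g m else RtoC 0).
  change (Csum f (S (next_RS (rs N))))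
    with (Csum f (next_RS (rs N)) + f (next_RS (rs N)))%C.
  rewrite (Csum_extend_zero f (S (rs N)) (next_RS (rs N))).
  - unfold f at 3. destruct (RS_dec (next_RS (rs N))); [reflexivity|tauto].
  - lia.
  - intros k Hk. unfold f. destruct (RS_dec k) as [H|]; [|reflexivity].
    specialize (Hmin k H). lia.
Qed.

Lemma RS_indicator (m : nat) (c : C) :
  1 <= m ->
  (if RS_dec m then c else RtoC 0) = ((c + rs_sign m * c) / RtoC 2)%C.
Proof.
  intros Hm. unfold rs_sign.
  destruct (RS_dec m) as [[_ H]|H]; unfold RS, rudin_shapiro in H.
  all: destruct (Nat.odd (f11 m)); try discriminate; try tauto.
  all: rewrite ?RtoC_m1; field; intros E; apply RtoC_inj in E; lra.
Qed.

(** The constant 1 corrects for [m = 0], which has sign 1 but is not in RS. *)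
Lemma sum_RS_split (z : C) (M : nat) :
  Csum (fun m => if RS_dec m then z ^ m else RtoC 0)%C (S M) =
  ((Csum (fun m => z ^ m) (S M) + rs_poly (S M) z) / RtoC 2 - RtoC 1)%C.
Proof.
  unfold rs_poly. induction M as [|M IH].
  - simpl. destruct (RS_dec 0) as [[H _]|_]; [lia|].
    unfold rs_sign. simpl. field.
  - set (f := fun m => if RS_dec m then (z ^ m)%C else RtoC 0) in *.
    change (Csum f (S (S M))) with (Csum f (S M) + f (S M))%C.
    rewrite IH. unfold f. rewrite RS_indicator by lia.
    cbn [Csum]. field.
Qed.

(** Among [2 n] and [2 n + 1] with [n] odd exactly one belongs to RS, because
    appending the digit 1 to an odd number creates one more block 11.  Every
    window of length 7 therefore meets RS. *)
Lemma next_RS_gap (m : nat) : next_RS m <= m + 7.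
Proof.
  destruct (next_RS_spec m) as [_ [_ Hmin]].
  (* k is odd, and both 2 k and 2 k + 1 lie in m + 1, ..., m + 7 *)
  set (k := 2 * (m / 4 + 1) + 1).
  pose proof (Nat.div_mod m 4 ltac:(lia)) as Hdm.
  pose proof (Nat.mod_upper_bound m 4 ltac:(lia)) as Hub.
  assert (Hk : Nat.odd k = true).
  { unfold k. rewrite Nat.add_1_r, Nat.odd_succ, Nat.even_mul. reflexivity. }
  destruct (Nat.odd (f11 k)) eqn:E.
  - assert (HRS : RS (2 * k + 1)).
    { split; [lia|]. unfold rudin_shapiro.
      rewrite f11_succ_double, Hk, Nat.odd_add, E. reflexivity. }
    pose proof (Hmin _ HRS). lia.
  - assert (HRS : RS (2 * k)).
    { split; [lia|]. unfold rudin_shapiro. rewrite f11_double, E. reflexivity. }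
    pose proof (Hmin _ HRS). lia.
Qed.

Lemma rs_le_linear (N : nat) : rs N <= 7 * N.
Proof.
  induction N as [|N IH]; [simpl; lia|].
  change (rs (S N)) with (next_RS (rs N)).
  pose proof (next_RS_gap (rs N)). lia.
Qed.

(** * Exponential sums *)

Lemma Cmod_expi2pi (x : R) : Cmod (expi2pi x) = 1%R.
Proof.
  unfold Cmod, expi2pi. cbn [fst snd].
  replace (cos (2 * PI * x) ^ 2 + sin (2 * PI * x) ^ 2)%R with 1%R.
  - apply sqrt_1.
  - rewrite <- (sin2_cos2 (2 * PI * x)). unfold Rsqr. ring.
Qed.

Lemma expi2pi_nat_mult (n : nat) (x : R) :
  expi2pi (INR n * x) = (expi2pi x ^ n)%C.
Proof.
  induction n as [|n IH].
  - unfold expi2pi. simpl. rewrite Rmult_0_l, Rmult_0_r, cos_0, sin_0. reflexivity.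
  - rewrite Cpow_S, <- IH, S_INR. unfold expi2pi, Cmult. cbn [fst snd].
    replace (2 * PI * ((INR n + 1) * x))%R
      with (2 * PI * x + 2 * PI * (INR n * x))%R by ring.
    rewrite cos_plus, sin_plus. f_equal. ring.
Qed.

Lemma expi2pi_neq_1 (theta : R) : (0 < theta < 1)%R -> expi2pi theta <> RtoC 1.
Proof.
  intros Ht E. apply (f_equal fst) in E. cbn in E.
  replace (2 * PI * theta)%R with (2 * (PI * theta))%R in E by ring.
  rewrite cos_2a_sin in E.
  pose proof PI_RGT_0.
  assert (0 < sin (PI * theta))%R by (apply sin_gt_0; nra).
  nra.
Qed.

Lemma geom_sum_bound (z : C) (M : nat) :
  Cmod z = 1%R -> z <> RtoC 1 ->
  (Cmod (Csum (fun m => z ^ m)%C M) <= 2 / Cmod (RtoC 1 - z))%R.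
Proof.
  intros Hz Hz1.
  assert (Hne : (RtoC 1 - z)%C <> RtoC 0).
  { intros E. apply Hz1. replace z with (RtoC 1 - (RtoC 1 - z))%C by ring.
    rewrite E. ring. }
  assert (E : (Csum (fun m => z ^ m) M * (RtoC 1 - z))%C = (RtoC 1 - z ^ M)%C).
  { clear. induction M as [|M IH]; [simpl; ring|].
    simpl. rewrite Cmult_plus_distr_r, IH. ring. }
  apply Cmod_gt_0 in Hne.
  apply Rmult_le_reg_r with (Cmod (RtoC 1 - z)); [exact Hne|].
  rewrite <- Cmod_mult, E. unfold Rdiv.
  rewrite Rmult_assoc, Rinv_l, Rmult_1_r by lra.
  eapply Rle_trans; [apply Cmod_triangle|].
  rewrite Cmod_opp, Cmod_1, Cmod_pow, Hz, pow1. lra.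
Qed.

Lemma sum_rs_bound (theta : R) (N : nat) :
  (0 < theta < 1)%R -> 1 <= N ->
  (Cmod (sum_n_m (fun n => expi2pi (INR (rs n) * theta)) 1 N)
   <= (1 / Cmod (RtoC 1 - expi2pi theta) + 10) * sqrt (INR N))%R.
Proof.
  intros Ht HN. set (z := expi2pi theta).
  assert (Hz : Cmod z = 1%R) by apply Cmod_expi2pi.
  assert (Hz1 : z <> RtoC 1) by now apply expi2pi_neq_1.
  rewrite (sum_n_m_ext _ (fun n => (z ^ rs n)%C))
    by (intros n; apply expi2pi_nat_mult).
  rewrite (sum_rs_reindex (fun m => z ^ m)%C).
  rewrite sum_RS_split.
  pose proof (geom_sum_bound z (S (rs N)) Hz Hz1) as HG.
  pose proof (rs_poly_bound (S (rs N)) z Hz) as HP.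
  set (G := Csum _ _) in *. set (P := rs_poly _ _) in *.
  assert (HsN : (1 <= sqrt (INR N))%R)
    by (rewrite <- sqrt_1; apply sqrt_le_1_alt; apply (le_INR 1); lia).
  (* rs N + 1 <= 7 N + 1 <= 9 N, and 9 is a perfect square *)
  assert (Hs9 : (sqrt (INR (S (rs N))) <= 3 * sqrt (INR N))%R).
  { rewrite <- (sqrt_square 3) by lra. rewrite <- sqrt_mult_alt by lra.
    apply sqrt_le_1_alt. pose proof (rs_le_linear N) as H.
    replace (3 * 3)%R with (INR 9) by (simpl; lra).
    rewrite <- mult_INR. apply le_INR. lia. }
  assert (Hinv : (0 < / Cmod (RtoC 1 - z))%R).
  { apply Rinv_0_lt_compat, Cmod_gt_0. intros E. apply Hz1.
    replace z with (RtoC 1 - (RtoC 1 - z))%C by ring. rewrite E. ring. }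
  assert (HT : (Cmod ((G + P) / RtoC 2 - RtoC 1) <= (Cmod G + Cmod P) / 2 + 1)%R).
  { eapply Rle_trans; [apply Cmod_triangle|].
    rewrite Cmod_opp, Cmod_1, Cmod_div, (Cmod_R 2), Rabs_pos_eq
      by (lra || (intros E; apply RtoC_inj in E; lra)).
    pose proof (Cmod_triangle G P). lra. }
  unfold Rdiv in *. nra.
Qed.

Lemma filterlim_C_of_Cmod (u : nat -> C) :
  is_lim_seq (fun n => Cmod (u n)) 0%R ->
  filterlim u eventually (locally (RtoC 0)).
Proof.
  intros H. apply filterlim_locally. intros eps.
  apply is_lim_seq_spec in H. destruct (H eps) as [n0 Hn0].
  exists n0. intros n Hn. specialize (Hn0 n Hn).
  rewrite Rminus_0_r, Rabs_pos_eq in Hn0 by apply Cmod_ge_0.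
  pose proof (Rmax_Cmod (u n)) as HM.
  pose proof (Rmax_l (Rabs (fst (u n))) (Rabs (snd (u n)))).
  pose proof (Rmax_r (Rabs (fst (u n))) (Rabs (snd (u n)))).
  split.
  - change (Rabs (fst (u n) - 0) < eps)%R. rewrite Rminus_0_r. lra.
  - change (Rabs (snd (u n) - 0) < eps)%R. rewrite Rminus_0_r. lra.
Qed.

Lemma is_lim_seq_inv_sqrt (K : R) :
  is_lim_seq (fun N => K * / sqrt (INR N))%R 0%R.
Proof.
  replace (Finite 0) with (Rbar_mult (Finite K) (Finite 0))
    by (simpl; f_equal; ring).
  apply is_lim_seq_scal_l.
  apply (is_lim_seq_inv _ p_infty); [|discriminate].
  apply (filterlim_comp _ _ _ INR sqrt _ (Rbar_locally p_infty)).
  - apply is_lim_seq_INR.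
  - apply filterlim_sqrt_p.
Qed.

Theorem corollary11 : uniformly_behaved rs.
Proof.
  intros theta Ht. apply filterlim_C_of_Cmod.
  set (K := (1 / Cmod (RtoC 1 - expi2pi theta) + 10)%R).
  apply (is_lim_seq_le_le_loc (fun _ => 0%R) _ (fun N => K * / sqrt (INR N))%R).
  - exists 1. intros N HN. split; [apply Cmod_ge_0|].
    rewrite Cmod_mult, Cmod_R.
    assert (HN0 : (0 < INR N)%R) by (apply lt_0_INR; lia).
    rewrite Rabs_pos_eq by (left; now apply Rinv_0_lt_compat).
    pose proof (sum_rs_bound theta N Ht HN) as HB. fold K in HB.
    apply Rmult_le_reg_l with (INR N); [exact HN0|].
    rewrite <- Rmult_assoc, Rinv_r, Rmult_1_l by lra.
    eapply Rle_trans; [exact HB|]. apply Req_le.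
    rewrite <- (sqrt_sqrt (INR N)) at 2 by lra. field.
    apply Rgt_not_eq, sqrt_lt_R0, HN0.
  - apply is_lim_seq_const.
  - apply is_lim_seq_inv_sqrt.
Qed.
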